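(* Let $p$ be a prime and $G=\mathbb{Z}\times\mathbb{Z}_p=\langle z\rangle\times\langle a\rangle$. If $\mathcal{S}$ is a Schur ring over $G$ such that $\mathbb{Z}=\langle z\rangle$ is an $\mathcal{S}$-subgroup, then $\mathcal{S}$ is an automorphic Schur ring.
   Context: $F$ is a field of characteristic $0$; $\mathbb{Z}=\langle z\rangle$ infinite cyclic, $\mathbb{Z}_p=\langle a\rangle$ cyclic of order $p$, written multiplicatively. For finite $C\subseteq G$, $\overline{C}=\sum_{g\in C}g$ and $C^*=\{g^{-1}:g\in C\}$. A Schur ring over $G$ is a subspace $\mathcal{S}=\mathrm{Span}_F\{\overline{C}:C\in\mathcal{D}\}$ of $F[G]$, where $\mathcal{D}$ is a partition of $G$ into finite subsets with $\{1\}\in\mathcal{D}$, $C\in\mathcal{D}\Rightarrow C^*\in\mathcal{D}$, and each $\overline{C}\,\overline{D}$ a finite $F$-linear combination of the $\overline{E}$, $E\in\mathcal{D}$. An $\mathcal{S}$-subgroup is a subgroup that is a union of members of $\mathcal{D}$. $\mathcal{S}$ is automorphic if $\mathcal{S}=F[G]^{\mathcal{H}}$ (the set of elements of $F[G]$ fixed by $\mathcal{H}$; equivalently its classes are the $\mathcal{H}$-orbits on $G$) for some finite subgroup $\mathcal{H}\le\operatorname{Aut}(G)$. *)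

(* Defs.v *)
From HB Require Import structures.
From mathcomp Require Import all_boot all_order all_algebra.
From mathcomp Require Import finmap.
From Stdlib Require List.
Set Implicit Arguments. Unset Strict Implicit. Unset Printing Implicit Defensive.
Import GRing.Theory.
Local Open Scope ring_scope.
Local Open Scope fset_scope.

(* The group G = Z x Z_p, written additively on pairs:
   (n, k) stands for z^n a^k.  (p is prime in the theorem, so 'Z_p has order p.) *)
Definition grp (p : nat) : Type := (int * 'Z_p)%type.

Section Defs.
Variable p : nat.
Local Notation G := (grp p).

Definition gone : G := (0%R, 0%R).
Definition gmul (x y : G) : G := (x.1 + y.1, x.2 + y.2)%R.
Definition ginv (x : G) : G := (- x.1, - x.2)%R.

Definition inZ (g : G) : Prop := g.2 = 0%R.

Definition is_partition (D : {fset G} -> Prop) : Prop :=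
  (forall C, D C -> C != fset0) /\
  (forall g : G, exists C, D C /\ g \in C) /\
  (forall C1 C2 (g : G), D C1 -> D C2 -> g \in C1 -> g \in C2 -> C1 = C2).

Variable F : fieldType.

(* Elements of F[G] are represented by their coefficient functions G -> F
   with finite support. *)
Definition in_group_alg (f : G -> F) : Prop :=
  exists s : seq G, forall g, f g != 0 -> g \in s.

Definition csum (C : {fset G}) : G -> F := fun g => (g \in C)%:R.

Definition cprod (C E : {fset G}) : G -> F :=
  fun g => \sum_(c <- C) \sum_(e <- E) (gmul c e == g)%:R.

Definition lin_comb (D : {fset G} -> Prop) (f : G -> F) : Prop :=
  exists l : seq ({fset G} * F),
    (forall e, List.In e l -> D e.1) /\
    (forall g, f g = \sum_(e <- l) e.2 * csum e.1 g).

Definition schur_partition (D : {fset G} -> Prop) : Prop :=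
  is_partition D /\
  D [fset gone] /\
  (forall C, D C -> D [fset ginv x | x in C]) /\
  (forall C E, D C -> D E -> lin_comb D (cprod C E)).

Definition schur_ring (D : {fset G} -> Prop) : (G -> F) -> Prop := lin_comb D.

(* S-subgroup H (given as a predicate which is a subgroup): union of members of D *)
Definition is_S_subset (D : {fset G} -> Prop) (H : G -> Prop) : Prop :=
  exists Dsub : {fset G} -> Prop,
    (forall C, Dsub C -> D C) /\
    (forall g, H g <-> exists C, Dsub C /\ g \in C).

Definition is_aut (f : G -> G) : Prop :=
  (forall x y, f (gmul x y) = gmul (f x) (f y)) /\ bijective f.

Definition inH (H : seq (G -> G)) (h : G -> G) : Prop :=
  exists2 k, List.In k H & h =1 k.

Definition finite_aut_subgroup (H : seq (G -> G)) : Prop :=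
  (forall h, List.In h H -> is_aut h) /\
  inH H id /\
  (forall h k, List.In h H -> List.In k H -> inH H (h \o k)) /\
  (forall h, List.In h H -> exists k, inH H k /\ cancel h k /\ cancel k h).

(* F[G]^H : elements of F[G] fixed by every h in H, where h acts by
   h . (sum_g f(g) g) = sum_g f(g) h(g), i.e. the coefficient function
   becomes f o h^{-1}; fixed for all h in the group H iff f o h = f. *)
Definition fixed_alg (H : seq (G -> G)) (f : G -> F) : Prop :=
  in_group_alg f /\ (forall h, List.In h H -> forall g, f (h g) = f g).

Definition automorphic (D : {fset G} -> Prop) : Prop :=
  exists H : seq (G -> G), finite_aut_subgroup H /\
    (forall f : G -> F, schur_ring D f <-> fixed_alg H f).

End Defs.

(* Main.v *)
Require Import Defs.
From HB Require Import structures.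
From mathcomp Require Import all_boot all_order all_algebra.
From mathcomp Require Import fingroup action pgroup sylow.
From mathcomp Require Import finmap.
From mathcomp Require Import zify.
Import Order.TTheory GRing.Theory Num.Theory.
Set Implicit Arguments.
Unset Strict Implicit.
Unset Printing Implicit Defensive.
Local Open Scope ring_scope.

(* Call a finite union of classes an S-set.  By Schur's multiplier argument,
   x |-> x^m maps S-sets on which it is injective to S-sets.  Hence the class
   of z lies in {z, z^-1}, so every {z^n, z^-n} is an S-set; taking m = p + 1
   shows that Z_p is one as well, and so is every level {z^n, z^-n} Z_p.
   Powers and products with {z^d, z^-d} now carry an S-set at a level n > 0 to
   the S-set {z^(c sgn i) a^(v j) : z^i a^j in s}, for all integers c and all
   v != 0 mod p.  Let C be the class of z a.  Moving C around this way shows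
   that the class of z^n a^k is contained in {z^(e n) a^(u k) : z^e a^u in C},
   and moving that class back to z a shows that it is not smaller.  For
   z^n a^k in C this says that the pairs (e, u) with z^e a^u in C form a group,
   which therefore acts on G by automorphisms with the classes as orbits. *)

(* S-sets are represented by sequences, and (possibly infinite) unions of
   classes by predicates that are class functions. *)
Definition class_fun (G : choiceType) (D : {fset G} -> Prop) (T : Type) (f : G -> T) :=
  forall C g h, D C -> g \in C -> h \in C -> f g = f h.

Definition sset (G : choiceType) (D : {fset G} -> Prop) (s : seq G) :=
  class_fun D (fun g => g \in s).

(** * Words over a finite set and their sums *)

Section Words.
Variables (G : zmodType) (A : {fset G}).

(** Multiplicities in [words k] are the coefficients of the k-th power of the sum of [A] in the
    group ring. *)
Fixpoint words k : seq G :=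
  if k is k'.+1 then [seq x + y | x <- A, y <- words k'] else [:: 0].

Definition tsum k (t : k.-tuple A) : G := \sum_(x <- t) val x.

Lemma count_allpairs_sum (g : G) (s t : seq G) :
  count_mem g [seq x + y | x <- s, y <- t] = \sum_(x <- s) count_mem (g - x) t.
Proof.
elim: s => [|x s IH]; first by rewrite big_nil.
rewrite allpairs_cons count_cat IH big_cons; congr (_ + _)%N.
by rewrite count_map; apply: eq_count => y /=; rewrite addrC (can2_eq (addrK _) (subrK _)).
Qed.

(** Turns a multiplicity into the size of a set of tuples, on which a group can act. *)
Lemma count_words k g : count_mem g (words k) = #|[set t : k.-tuple A | tsum t == g]|.
Proof.
elim: k g => [|k IH] g.
  rewrite /= addn0; have [<-|ng] := eqVneq 0 g.
    rewrite (_ : [set t | _] = setT) ?cardsT ?card_tuple ?expn0 //.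
    by apply/setP=> t; rewrite !inE tuple0 /tsum big_nil eqxx.
  apply/esym/eqP; rewrite cards_eq0; apply/eqP/setP => t.
  by rewrite !inE tuple0 /tsum big_nil (negPf ng).
rewrite count_allpairs_sum big_seq_fsetE /= -sum1_card.
rewrite (reindex (fun p : A * k.-tuple A => [tuple of p.1 :: p.2])) /=; last first.
  exists (fun t => (thead t, [tuple of behead t])) => [[x t] _|t _] /=.
    by congr (_, _); apply: val_inj.
  by apply: val_inj; rewrite /= [t in RHS]tuple_eta.
rewrite (eq_bigl (fun p : A * k.-tuple A => tsum p.2 == g - val p.1)).
  rewrite -(pair_big_dep xpredT (fun (x : A) (t : k.-tuple A) => tsum t == g - val x)
    (fun _ _ => 1%N)) /=.
  apply: eq_bigr => x _; rewrite IH -sum1_card; apply: eq_bigl => t; by rewrite inE.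
by move=> [x t]; rewrite inE /tsum /= big_cons addrC (can2_eq (addrK _) (subrK _)).
Qed.

End Words.

(** * Words of prime length under cyclic rotation *)

Section Rotation.
Variables (G : zmodType) (A : {fset G}) (k : nat).
Local Notation q := k.+2.

(** Here ['I_q] is the additive group Z/q, so the index [i + r] wraps around. *)
Definition rotate (t : q.-tuple A) (r : 'I_q) : q.-tuple A :=
  [tuple tnth t (i + r) | i < q].

Lemma rotate_is_action : is_action [set: 'I_q] rotate.
Proof.
apply: is_total_action => [t|t r s]; apply: eq_from_tnth => i.
  by rewrite tnth_mktuple addr0.
rewrite !tnth_mktuple; congr tnth.
by rewrite -addrA; congr (_ + _); rewrite addrC.
Qed.

Canonical rotate_action := Action rotate_is_action.

Lemma tsum_rotate t r : tsum (rotate t r) = tsum t.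
Proof.
rewrite /tsum !big_tuple (reindex (fun i : 'I_q => i - r)) /=.
  by apply: eq_bigr => i _; rewrite tnth_mktuple subrK.
by exists (fun i => i + r) => i _; rewrite (subrK, addrK).
Qed.

(* Rotation by Z_q acts on the q-letter words with a given sum; the fixed
   points are the constant words. *)
Lemma count_words_prime g : prime q -> {in A &, injective (fun x => x *+ q)} ->
  count_mem g (words A q) = (g \in [seq x *+ q | x <- A]) %[mod q].
Proof.
move=> q_pr injq; rewrite count_words.
set S := [set t | _].
have inS u : (u \in S) = (tsum u == g) by rewrite inE.
have act : [acts [set: 'I_q], on S | rotate_action]%g.
  by apply/actsP => r _ t; rewrite /= !inE tsum_rotate.
have pG : (q.-group [set: 'I_q])%g by rewrite /pgroup cardsT card_ord pnat_id.
rewrite (pgroup_fix_mod pG act); congr (_ %% _)%N.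
have fixE t : t \in 'Fix_(rotate_action)([set: 'I_q])%g -> t = [tuple of nseq q (tnth t 0)].
  move=> /afixP fx; apply: eq_from_tnth => i.
  have := congr1 (fun u => tnth u 0) (fx i (in_setT _)).
  by rewrite /= tnth_mktuple add0r tnth_nseq.
have sumn x : tsum [tuple of nseq q x] = val x *+ q :> G.
  by rewrite /tsum -[tval _]/(nseq q x) big_nseq iter_addr_0.
(* By injectivity at most one constant word sums to [g], so there is one fixed point or none. *)
case: (boolP (g \in _)) => [/mapP[x xA gE]|/mapP nx].
  apply/eqP/cards1P; exists [tuple of nseq q [` xA]%fset].
  apply/setP=> t; rewrite in_setI in_set1 inS gE.
  apply/andP/eqP => [[/eqP ts /fixE tf]|->].
    rewrite tf; congr [tuple of nseq q _]; apply: val_inj => /=.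
    by apply: injq => //=; rewrite -[RHS]ts [in RHS]tf sumn.
  rewrite sumn; split=> //; apply/afixP => r _ /=.
  by apply: eq_from_tnth => i; rewrite tnth_mktuple !tnth_nseq.
apply/eqP; rewrite cards_eq0; apply/eqP/setP => t.
rewrite in_setI in_set0 inS; apply/andP=> [[/eqP ts /fixE tf]]; apply: nx.
exists (val (tnth t 0)); first exact: valP.
by rewrite -ts tf sumn tnth_nseq.
Qed.

End Rotation.

(** * S-sets in an abelian group and Schur's multiplier argument *)

Section SchurPartition.
Variables (G : zmodType) (D : {fset G} -> Prop).
Hypothesis D_cover : forall g, exists2 C, D C & g \in C.
Hypothesis D_one : D [fset 0]%fset.
Hypothesis D_disj : forall C E g, D C -> D E -> g \in C -> g \in E -> C = E.
Hypothesis D_mul : forall C E, D C -> D E ->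
  class_fun D (fun g => count_mem g [seq x + y | x <- C, y <- E]).

(** The multiset form of [sset]: the multiplier argument needs multiplicities, not only supports. *)
Definition sbag (s : seq G) := class_fun D (fun g => count_mem g s).

Lemma class_sset C : D C -> sset D C.
Proof.
move=> DC E g h DE gE hE; apply/idP/idP => [gC|hC].
  by rewrite (D_disj DC DE gC gE).
by rewrite (D_disj DC DE hC hE).
Qed.

Lemma uniq_sset_bag s : uniq s -> sset D s -> sbag s.
Proof. by move=> us ss C g h DC gC hC; rewrite !count_uniq_mem // (ss C g h). Qed.

Lemma bag_sset s : sbag s -> sset D s.
Proof. by move=> bs C g h DC gC hC; rewrite -!has_pred1 !has_count (bs C g h). Qed.

Lemma sset_eq s t : s =i t -> sset D s -> sset D t.
Proof. by move=> st ss C g h DC gC hC; rewrite -!st; exact: ss hC. Qed.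

Lemma sset_filter (P : pred G) s : class_fun D P -> sset D s -> sset D (filter P s).
Proof.
move=> cP ss C g h DC gC hC; rewrite !mem_filter (cP C g h) //; congr (_ && _).
exact: ss hC.
Qed.

Lemma sset_sub C s g : D C -> sset D s -> g \in C -> g \in s -> {subset C <= s}.
Proof. by move=> DC ss gC gs h hC; rewrite -(ss C g h DC gC hC). Qed.

(** A bag is a multiset union of classes: multiplicities are constant on the class of any entry, so
    that class occurs in full, and removing one copy leaves a smaller bag. *)
Lemma sbag_ind (P : seq G -> Prop) :
  P [::] -> (forall s t, perm_eq s t -> P s -> P t) ->
  (forall (C : {fset G}) s, D C -> P s -> P (C ++ s)) ->
  forall s, sbag s -> P s.
Proof.
move=> P0 Pp Pc s; have [n] := ubnP (size s).
elim: n s => // n IH [//|x s0]; set s := x :: s0 => sz bs.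
have [C DC xC] := D_cover x.
have /count_subseqP[r rs pr] : forall y, (count_mem y C <= count_mem y s)%N.
  move=> y; rewrite count_uniq_mem ?fset_uniq //; case: (boolP (y \in C)) => // yC.
  by have -> : count_mem y s = count_mem x s := bs C y x DC yC xC; rewrite /s /= eqxx.
have [s3 p3] := perm_to_subseq rs.
have p4 : perm_eq (C ++ s3) s by rewrite perm_sym (perm_trans p3) // perm_cat2r perm_sym.
apply: (Pp _ _ p4); apply: Pc => //; apply: IH.
  have := perm_size p4; rewrite size_cat => E.
  have : (0 < size C)%N by rewrite -has_predT; apply/hasP; exists x.
  by move=> C0; rewrite -ltnS (leq_trans _ sz) // ltnS -E -[X in (X < _)%N]add0n ltn_add2r.
move=> E g h DE gE hE; apply: (@addnI (count_mem g C)).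
rewrite -count_cat (permP p4) (uniq_sset_bag (fset_uniq C) (class_sset DC) DE gE hE) //.
by rewrite -count_cat (permP p4); apply: bs hE.
Qed.

Lemma sbag_add s t : sbag s -> sbag t -> sbag [seq x + y | x <- s, y <- t].
Proof.
move=> bs bt; move: s bs; apply: sbag_ind => // [s s' ss b|C s DC b].
  move=> E g h DE gE hE.
  have p : perm_eq [seq x + y | x <- s, y <- t] [seq x + y | x <- s', y <- t].
    by apply: perm_allpairs_dep.
  by rewrite -!(permP p); exact: b hE.
move=> E g h DE gE hE; rewrite allpairs_cat !count_cat (b E g h) //; congr (_ + _)%N.
move: t bt {b}; apply: sbag_ind => // [||C' t DC' b].
- by rewrite (allpairs0r).
- move=> t t' tt b.
  have p : perm_eq [seq x + y | x <- C, y <- t] [seq x + y | x <- C, y <- t'].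
    by apply: perm_allpairs_dep.
  by rewrite -!(permP p).
have p := perm_allpairs_catr (fun x y : G => x + y) C (fun _ => C') (fun _ => t).
move/permPl: p => pe.
by rewrite !(permP pe) !count_cat b (D_mul DC DC' DE gE hE).
Qed.

Lemma sset_add s t : sset D s -> sset D t -> sset D [seq x + y | x <- s, y <- t].
Proof.
move=> ss st.
apply: (@sset_eq [seq x + y | x <- undup s, y <- undup t]).
  by apply: mem_allpairs => z; rewrite mem_undup.
apply/bag_sset/sbag_add; apply: uniq_sset_bag (undup_uniq _) _;
  by apply: sset_eq (fun z => esym (mem_undup _ z)) _.
Qed.

Lemma sset_cat s t : sset D s -> sset D t -> sset D (s ++ t).
Proof.
move=> ss st C g h DC gC hC; rewrite !mem_cat.
by congr (_ || _); [apply: ss hC | apply: st hC].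
Qed.

Lemma sbag_words (A : {fset G}) k : sset D A -> sbag (words A k).
Proof.
move=> sA; elim: k => [|k IH].
  apply: uniq_sset_bag => //; apply: sset_eq (class_sset D_one) => x.
  by rewrite !inE.
by apply: sbag_add => //; apply: uniq_sset_bag => //; apply: fset_uniq.
Qed.

(** Modulo q, the multiplicities in [words A q] are the indicator of the image of [A]. They are
    constant on classes, and 0 and 1 differ modulo q. *)
Lemma sset_mulrn_prime q s : prime q -> {in s &, injective (fun x => x *+ q)} ->
  sset D s -> sset D [seq x *+ q | x <- s].
Proof.
move=> q_pr injq ss; pose A := [fset x in s]%fset.
have As : A =i s by move=> x; rewrite !inE.
have sA : sset D A by apply: sset_eq (fun z => esym (As z)) ss.
have injA : {in A &, injective (fun x => x *+ q)}.
  by move=> x y; rewrite !As; apply: injq.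
apply: (@sset_eq [seq x *+ q | x <- A]); first exact: eq_mem_map.
case: q q_pr {injq} injA => [|[|k]] // q_pr injA C g h DC gC hC.
have eg := count_words_prime g q_pr injA.
have eh := count_words_prime h q_pr injA.
move: eg; rewrite (sbag_words k.+2 sA DC gC hC) eh.
by rewrite !modn_small; [case: (g \in _); case: (h \in _) | case: (_ \in _)..].
Qed.

(** Split off a prime factor q of m = d q. Injectivity of m on [s] gives that of d on [s] and of q
    on the image. *)
Lemma sset_mulrn m s : (0 < m)%N -> {in s &, injective (fun x => x *+ m)} ->
  sset D s -> sset D [seq x *+ m | x <- s].
Proof.
have [n] := ubnP m; elim: n m s => // n IH m s mn m0 injm ss.
have [m1|m1] := leqP m 1%N.
  have -> : m = 1%N by lia.
  by rewrite (eq_map (mulr1n (V := G))) map_id.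
have q_pr := pdiv_prime m1; set q := pdiv m in q_pr.
have [d dE] : exists d, m = (d * q)%N by apply/dvdnP; exact: pdiv_dvd.
have q1 := prime_gt1 q_pr.
apply: (@sset_eq [seq x *+ q | x <- [seq x *+ d | x <- s]]).
  by rewrite -map_comp; move=> x; congr (_ \in _); apply: eq_map => y /=; rewrite -mulrnA dE.
apply: sset_mulrn_prime => //.
  by move=> _ _ /mapP[x xs ->] /mapP[y ys ->]; rewrite -!mulrnA -dE => /injm ->.
apply: IH => //; [nia|nia|].
by move=> x y xs ys /= xy; apply: injm => //=; rewrite dE !mulrnA xy.
Qed.

End SchurPartition.

(** * Arithmetic of Z x Z_p *)

Section IntZp.
Variable p : nat.
Hypothesis p_pr : prime p.
Local Notation G := (int * 'Z_p)%type.

Lemma unit_Zp (v : 'Z_p) : v != 0 -> v \is a GRing.unit.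
Proof.
move=> v0; rewrite -(natr_Zp v) unitZpE ?prime_gt1 // prime_coprime //.
rewrite gtnNdvd ?lt0n //.
by have := ltn_ord v; rewrite [X in (_ < X)%N -> _](Zp_cast (prime_gt1 p_pr)).
Qed.

Lemma coprime_Zp (v : 'Z_p) : v != 0 -> coprime p v.
Proof. by move/unit_Zp; rewrite -{1}(natr_Zp v) unitZpE ?prime_gt1. Qed.

Lemma mulrnZp (v : 'Z_p) : v *+ p = 0.
Proof. by rewrite -mulr_natr pchar_Zp ?prime_gt1 // mulr0. Qed.

Lemma pair_mulrn (x : G) m : x *+ m = (x.1 * m%:Z, x.2 *+ m).
Proof.
case: x => a b /=; elim: m => [|m IH]; first by rewrite mulr0.
by rewrite mulrSr IH intS mulrDr mulr1 mulrSr addrC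
  -[LHS]/(a + _, b + _) [b + _]addrC.
Qed.

Lemma mulrn_coprime_inj m : (0 < m)%N -> coprime p m -> injective (fun x : G => x *+ m).
Proof.
move=> m0 cm [a b] [c d]; rewrite !pair_mulrn /= => -[ac bd]; congr (_, _).
  by move: ac; nia.
have u : (m%:R : 'Z_p) \is a GRing.unit by rewrite unitZpE ?prime_gt1.
by apply: (mulIr u); rewrite !mulr_natr.
Qed.

Lemma intE (a : int) : a = `|a|%N%:Z * sgz a.
Proof. by rewrite mulrC -intEsg. Qed.

Lemma absz_sgz (a : int) : a != 0 -> `|sgz a|%N = 1%N.
Proof. by case: sgzP. Qed.

Lemma sgz_sqr (a : int) : a != 0 -> sgz a * sgz a = 1.
Proof. by case: sgzP. Qed.

Lemma sgz_abs1 (a : int) : `|a|%N = 1%N -> sgz a = a.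
Proof. by move=> a1; rewrite [RHS]intE a1 mul1r. Qed.

Definition torsion : seq G := [seq (0, k) | k <- enum 'Z_p].

Lemma mem_torsion x : (x \in torsion) = (x.1 == 0).
Proof.
apply/mapP/eqP => [[k _ ->] //|]; case: x => a k /= ->.
by exists k; rewrite ?mem_enum.
Qed.

Definition pm (n : nat) : seq G := [:: (n%:Z, 0); (- n%:Z, 0)].

Lemma mem_pm n (x : G) : (x \in pm n) = (x.2 == 0) && (`|x.1|%N == n).
Proof.
case: x => a k; rewrite !inE !xpair_eqE /=; case: (k == 0); rewrite ?andbT ?andbF //=.
by apply/orP/eqP; lia.
Qed.

(** The product of the ring Z x Z_p, so that group elements double as endomorphisms; [act_aut] tells
    which ones are used as automorphisms. *)
Definition act (h x : G) : G := (h.1 * x.1, h.2 * x.2).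

(** * The S-sets of Z, of Z_p and of the levels *)

Variable D : {fset G} -> Prop.
Hypothesis D_cover : forall g : G, exists2 C, D C & g \in C.
Hypothesis D_one : D [fset 0]%fset.
Hypothesis D_disj : forall C E (g : G), D C -> D E -> g \in C -> g \in E -> C = E.
Hypothesis D_mul : forall C E : {fset G}, D C -> D E ->
  class_fun D (fun g => count_mem g [seq x + y | x <- C, y <- E]).
Hypothesis D_opp : forall C : {fset G}, D C -> D [fset - x | x in C]%fset.
Hypothesis D_Z : class_fun D (fun g : G => g.2 == 0).

Let sset_mulrn := sset_mulrn D_cover D_one D_disj D_mul.
Let sset_add := sset_add D_cover D_disj D_mul.
Let class_sset := class_sset D_disj.

Lemma mem_oppr (s : seq G) x : (x \in [seq - y | y <- s]) = (- x \in s).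
Proof. by rewrite -{1}[x]opprK mem_map //; apply: oppr_inj. Qed.

Lemma mem_oppr_fset (C : {fset G}) x : (x \in [fset - y | y in C]%fset) = (- x \in C).
Proof.
apply/imfsetP/idP => [[y yC ->]|xC]; first by rewrite opprK.
by exists (- x); rewrite ?opprK.
Qed.

Lemma sset_opp (s : seq G) : sset D s -> sset D [seq - x | x <- s].
Proof.
move=> ss C g h DC gC hC; rewrite !mem_oppr; apply: (ss _ _ _ (D_opp DC));
  by rewrite mem_oppr_fset opprK.
Qed.

(** With m = |x.1|, the S-set m C contains (m, 0), which is x or -x. Hence it contains [C] or -C,
    and so an element with first coordinate 1 or -1, which forces m = 1. *)
Lemma class_generator (C : {fset G}) x :
  D C -> (1, 0) \in C -> x \in C -> x.2 = 0 /\ `|x.1|%N = 1%N.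
Proof.
move=> DC eC xC.
have Z y : y \in C -> y.2 = 0.
  by move=> yC; apply/eqP; rewrite (D_Z DC yC eC).
split; first exact: Z.
have x0 : x.1 <> 0.
  move=> x10; have x0 : x \in [fset 0]%fset.
    by rewrite inE; case: (x) x10 (Z _ xC) => a b /= -> ->.
  by have := eC; rewrite (D_disj DC D_one xC x0) inE.
set m := `|x.1|%N; have m0 : (0 < m)%N by rewrite absz_gt0; apply/eqP.
have sm : sset D [seq y *+ m | y <- C].
  apply: sset_mulrn => //; last exact: class_sset.
  move=> [a b] [c d] /Z /= -> /Z /= ->; rewrite !pair_mulrn => -[/= ac].
  by congr (_, _); move: ac; nia.
have mC : (m%:Z, 0) \in [seq y *+ m | y <- C].
  by apply/mapP; exists (1, 0) => //; rewrite pair_mulrn /= mul0rn mul1r.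
suff [y yC ey] : exists2 y : G, y \in C & `|(y *+ m).1|%N = 1%N.
  by move/eqP: ey; rewrite pair_mulrn abszM muln_eq1 => /andP[_ /eqP].
have [xm|xm] : x = (m%:Z, 0) \/ - x = (m%:Z, 0).
- by rewrite /m; case: (x) (Z _ xC) => a b /= ->; have [a0|a0] := leP 0 a; [left|right];
    rewrite -?[- (_, _)]/(- a, - 0) ?oppr0; congr (_, _); lia.
- rewrite -xm in mC.
  have /mapP[y yC ey] := sset_sub DC sm xC mC eC.
  by exists y => //; rewrite -ey.
have mC' : (m%:Z, 0) \in [fset - y | y in C]%fset by rewrite mem_oppr_fset -xm opprK.
have eC' : (-1, 0) \in [fset - y | y in C]%fset.
  by rewrite mem_oppr_fset -[- _]/(1, - 0) oppr0.
have /mapP[y yC ey] := sset_sub (D_opp DC) sm mC' mC eC'.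
by exists y => //; rewrite -ey.
Qed.

(** The class of z may be {z} or {z, z^-1}; joining its n-th multiple with the opposite of that
    multiple gives [pm n] in both cases. *)
Lemma sset_pm n : sset D (pm n).
Proof.
have [C DC eC] := D_cover (1, 0).
have CE x : x \in C -> x = (1, 0) \/ x = (-1, 0).
  move=> xC; have [] := class_generator DC eC xC; case: (x) => a b /= -> a1.
  have [->|->] : a = 1 \/ a = -1 by lia.
    by left.
  by right.
have [->|n0] := posnP n.
  by apply: sset_eq (class_sset D_one) => x; rewrite !inE /= orbb.
pose s := [seq x *+ n | x <- C].
have ss : sset D s.
  apply: sset_mulrn => //; last exact: class_sset.
  move=> x y /CE[]-> /CE[]->; rewrite !pair_mulrn => // /(congr1 fst) /=; lia.
apply: (@sset_eq _ _ (s ++ [seq - x | x <- s])); last first.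
  by apply: sset_cat => //; apply: sset_opp.
have sE x : x \in s -> x = (n%:Z, 0) \/ x = (- n%:Z, 0).
  case/mapP=> y /CE[]-> ->; rewrite pair_mulrn /= mul0rn; [left|right]; congr (_, _); lia.
have ns : (n%:Z, 0) \in s.
  by apply/mapP; exists (1, 0) => //; rewrite pair_mulrn /= mul0rn mul1r.
move=> x; rewrite mem_cat mem_oppr !inE; apply/orP/orP => [[/sE[]->|/sE xE]|[]/eqP->].
- by left.
- by right.
- case: xE => xE; rewrite -[x]opprK xE -[- _]/(- _, - 0) oppr0 ?opprK; [right|left] => //.
- by left.
- by right; rewrite -[- _]/(- _, - 0) opprK oppr0.
Qed.

(** Multiplication by p + 1 is injective and fixes torsion elements. If [C] contains one, then (p +
    1) C contains [C], so each element of [C] is p + 1 times another; descent on |y.1| leaves only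
    0. *)
Lemma fst0_class_fun : class_fun D (fun g : G => g.1 == 0).
Proof.
suff H C x y : D C -> x \in C -> y \in C -> x.1 = 0 -> y.1 = 0.
  by move=> C g h DC gC hC; apply/eqP/eqP; apply: H; eassumption.
move=> DC xC yC x0.
have sC : sset D [seq y *+ p.+1 | y <- C].
  apply: sset_mulrn => //; last exact: class_sset.
  by move=> a b _ _; apply: mulrn_coprime_inj => //; rewrite coprimenS.
have xs : x \in [seq y *+ p.+1 | y <- C].
  apply/mapP; exists x => //; rewrite pair_mulrn x0 mul0r mulrS mulrnZp addr0.
  by case: (x) x0 => a b /= ->.
have [n] := ubnP `|y.1|%N; elim: n y yC => // n IH y yC yn.
have /mapP[z zC yz] := sset_sub DC sC xC xs yC.
have y1 : y.1 = z.1 * p.+1%:Z by rewrite yz pair_mulrn.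
have p0 := prime_gt0 p_pr.
have [z0|z0] := eqVneq z.1 0; first by rewrite y1 z0 mul0r.
suff z1 : z.1 = 0 by rewrite z1 eqxx in z0.
apply: IH zC _; move: z0 yn; rewrite y1 abszM -absz_gt0 absz_nat; move: `|z.1|%N => a; rewrite mulnS; nia.
Qed.

Lemma sset_torsion : sset D torsion.
Proof. by move=> C g h DC gC hC; rewrite !mem_torsion; apply: fst0_class_fun hC. Qed.

(** Level n is the sum of the S-sets [pm n] and [torsion]. *)
Lemma absz_class_fun : class_fun D (fun g : G => `|g.1|%N).
Proof.
move=> C g h DC gC hC; set n := `|g.1|%N.
have memE x : (x \in [seq a + b | a <- pm n, b <- torsion]) = (`|x.1|%N == n).
  apply/allpairsP/eqP => [[[a b] /= []]|xn].
    rewrite mem_pm mem_torsion => /andP[_ /eqP <-] /eqP b0 ->.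
    by rewrite /= b0 addr0.
  exists ((x.1, 0), (0, x.2)); rewrite mem_pm mem_torsion /= xn !eqxx; split=> //.
  by case: (x) => a b; rewrite -[RHS]/(a + 0, 0 + b) addr0 add0r.
have ss := sset_add (sset_pm n) sset_torsion.
by have := ss C g h DC gC hC; rewrite !memE eqxx => /esym/eqP.
Qed.

(* Adding z^d + z^-d with d = |n - n'| sends level n to levels n' and
   |2n - n'|, and the part at level n' is the wanted copy of s. *)
Lemma sset_level n n' (s : seq G) : (0 < n)%N -> {in s, forall x, `|x.1|%N = n} ->
  sset D s -> sset D [seq (n'%:Z * sgz x.1, x.2) | x <- s].
Proof.
move=> n0 sn ss; have [<-|nn] := eqVneq n n'.
  rewrite map_id_in // => x xs; rewrite -{1}(sn x xs) -intE.
  by case: (x).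
pose d := `|n%:Z - n'%:Z|%N.
have cf : class_fun D (fun g : G => `|g.1|%N == n').
  by move=> C g h DC gC hC; rewrite (absz_class_fun DC gC hC).
apply: sset_eq (sset_filter cf (sset_add ss (sset_pm d))) => y.
rewrite mem_filter; apply/andP/mapP => [[/eqP yn /allpairsP[[a b] /= [aS]]]|[x xS ->]].
  rewrite mem_pm => /andP[/eqP b0 /eqP bd] yE; exists a => //.
  have an := sn a aS.
  move: yn; rewrite yE; case: a {yE aS} an => a1 a2; case: b b0 bd => b1 b2 /= -> bd an yn.
  rewrite -[LHS]/(a1 + b1, a2 + 0) addr0; congr (_, _).
  (* The other shift gives absolute value |2n - n'|, which is not n' because n > 0 and n differs
     from n'. *)
  by have [a0|a0] := leP 0 a1; [rewrite gtr0_sgz|rewrite ltr0_sgz]; lia.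
have xn := sn x xS; have x0 : x.1 != 0 by rewrite -absz_gt0 xn.
split; first by rewrite /= abszM absz_sgz // muln1.
apply/allpairsP; exists (x, ((n'%:Z - n%:Z) * sgz x.1, 0)); split=> //=.
  by rewrite mem_pm eqxx abszM absz_sgz // muln1 distnC -/d eqxx.
case: (x) xn => a b /= an; rewrite -[RHS]/(a + _, b + 0) addr0; congr (_, _).
by rewrite mulrBl -{1}an -intE addrC subrK.
Qed.

(** Multiplying by the representative [u] of a nonzero residue, which is coprime to p, leads to
    level n u; [sset_level] then moves to level |c|. *)
Lemma sset_transfer n (c : int) v (s : seq G) :
  (0 < n)%N -> v != 0 -> {in s, forall x, `|x.1|%N = n} ->
  sset D s -> sset D [seq (c * sgz x.1, v * x.2) | x <- s].
Proof.
move=> n0 v0 sn ss.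
have pos (n' : nat) u : u != 0 -> sset D [seq (n'%:Z * sgz x.1, u * x.2) | x <- s].
  move=> u0; have u_gt0 : (0 < u)%N by rewrite lt0n.
  have su : sset D [seq x *+ u | x <- s].
    apply: sset_mulrn => // x y _ _; apply: mulrn_coprime_inj => //.
    exact: coprime_Zp.
  have lu : {in [seq x *+ u | x <- s], forall x, `|x.1|%N = (n * u)%N}.
    by move=> _ /mapP[x /sn xn ->]; rewrite pair_mulrn abszM xn.
  have := @sset_level (n * u) n' _ _ lu su; rewrite muln_gt0 n0 u_gt0 => /(_ isT).
  apply: sset_eq => y; rewrite -map_comp; congr (y \in _); apply: eq_map => x /=.
  by rewrite pair_mulrn /= -mulr_natl natr_Zp sgzM [sgz _%:Z]gtr0_sgz ?mulr1.
have [c0|c0] := leP 0 c.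
  by have := pos `|c|%N v v0; rewrite gez0_abs.
(* Inversion changes both signs, so a negative [c] is reached from |c| and -v. *)
have := sset_opp (pos `|c|%N (- v) _); rewrite oppr_eq0 => /(_ v0).
apply: sset_eq => y; rewrite -map_comp; congr (y \in _); apply: eq_map => x /=.
by rewrite -[LHS]/(- _, - _) -!mulNr opprK ltz0_abs // opprK.
Qed.

(** * The class of z a and its orbits *)

Variable C : {fset G}.
Hypothesis DC : D C.
Hypothesis eC : (1, 1) \in C.

Lemma gen_level : {in C, forall x, `|x.1|%N = 1%N}.
Proof. by move=> x xC; rewrite (absz_class_fun DC xC eC). Qed.

Lemma gen_sgz : {in C, forall x, sgz x.1 = x.1}.
Proof. by move=> x /gen_level/sgz_abs1. Qed.

Lemma gen_snd : {in C, forall x, x.2 != 0}.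
Proof. by move=> x xC; rewrite (D_Z DC xC eC) oner_eq0. Qed.

(** For [g.2] nonzero this is [sset_transfer] with c = [g.1] and v = [g.2]. For [g.2] = 0 that v is
    forbidden, so [C] is first projected to Z. *)
Lemma sset_orbit g : sset D [seq act h g | h <- C].
Proof.
have sC := class_sset DC.
have [k0|k0] := eqVneq g.2 0; last first.
  apply: sset_eq (sset_transfer g.1 (ltn0Sn 0) k0 gen_level sC) => y.
  congr (y \in _); apply/eq_in_map => h hC.
  by rewrite gen_sgz // /act mulrC [_ * h.2]mulrC.
(* The projection of [C] to Z, obtained as the part of [C] + [torsion] inside Z. *)
pose s := [seq x <- [seq a + b | a <- C, b <- torsion] | x.2 == 0].
have sP x : reflect (exists2 h, h \in C & x = (h.1, 0)) (x \in s).
  rewrite mem_filter; apply: (iffP andP) => [[/eqP x0 /allpairsP[[a b] /= [aC bT xE]]]|[h hC ->]].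
    exists a => //; move: bT x0; rewrite mem_torsion xE => /eqP b0 /= x0.
    by rewrite -[LHS]/(a.1 + b.1, a.2 + b.2) b0 x0 addr0.
  split=> //; apply/allpairsP; exists (h, (0, - h.2)); split=> //=.
    by rewrite mem_torsion.
  by rewrite -[RHS]/(h.1 + 0, h.2 - h.2) addr0 subrr.
have ls : {in s, forall x, `|x.1|%N = 1%N}.
  by move=> x /sP[h hC ->]; rewrite /= gen_level.
have ss : sset D s := sset_filter D_Z (sset_add sC sset_torsion).
apply: sset_eq (sset_transfer g.1 (ltn0Sn 0) (oner_neq0 _) ls ss) => y.
apply/mapP/mapP => [[x /sP[h hC ->] ->]|[h hC ->]].
  by exists h => //=; rewrite gen_sgz // /act k0 mulrC !mulr0.
exists (h.1, 0); first by apply/sP; exists h.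
by rewrite /= gen_sgz // /act k0 mulrC !mulr0.
Qed.

Lemma orbit_sub (X : {fset G}) g h : D X -> g \in X -> h \in C -> act h g \in X.
Proof.
move=> DX gX hC; have sX := class_sset DX.
(* [W] is a copy of [X] at level 1, with [g] placed over 1; [WX] leads back to [X]. For [g.1] = 0 it
   comes from adding [pm 1], otherwise from rescaling. *)
have [W [sW gW lW WX]] : exists W : seq G, [/\ sset D W, (1, g.2) \in W,
    {in W, forall w, `|w.1|%N = 1%N} & {in W, forall w, (w.1 * g.1, w.2) \in X}].
  have [n0|n0] := eqVneq g.1 0.
    have X0 x : x \in X -> x.1 = 0.
      by move=> xX; apply/eqP; rewrite (fst0_class_fun DX xX gX) n0.
    exists [seq x + y | x <- X, y <- pm 1]; split; first exact: sset_add (sset_pm 1).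
    - apply/allpairsP; exists (g, (1, 0)); split=> //.
      by rewrite -[RHS]/(g.1 + 1, g.2 + 0) n0 add0r addr0.
    - move=> _ /allpairsP[[x y] /= [xX yP ->]]; move: yP; rewrite mem_pm => /andP[_ /eqP y1].
      by rewrite /= X0 // add0r.
    move=> _ /allpairsP[[x y] /= [xX yP ->]]; move: yP; rewrite mem_pm => /andP[/eqP y2 _].
    by rewrite /= y2 n0 mulr0 addr0; move: (xX); rewrite {1}[x]surjective_pairing X0.
  have n1 : (0 < `|g.1|)%N by rewrite absz_gt0.
  have lX : {in X, forall x, `|x.1|%N = `|g.1|%N}.
    by move=> x xX; rewrite (absz_class_fun DX xX gX).
  have x0 x : x \in X -> x.1 != 0 by move=> xX; rewrite -absz_gt0 lX.
  exists [seq (sgz g.1 * sgz x.1, 1 * x.2) | x <- X]; split.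
  - exact: sset_transfer lX sX.
  - by apply/mapP; exists g => //; rewrite mul1r sgz_sqr.
  - by move=> _ /mapP[x xX ->] /=; rewrite abszM !absz_sgz ?x0.
  move=> _ /mapP[x xX ->] /=; rewrite mul1r mulrAC -abszEsg -(lX x xX) -intE.
  by rewrite -surjective_pairing.
(* To reach (1, 1) from (1, [g.2]), divide by [g.2] if it is nonzero, else add [torsion]. The
   resulting S-set then contains [C]. *)
have [k0|k0] := eqVneq g.2 0; last first.
  have ku := unit_Zp k0.
  have sV := sset_transfer 1 (ltn0Sn 0) (_ : g.2^-1 != 0) lW sW.
  have {sV} /sV sV : g.2^-1 != 0 by rewrite -unitrV in ku; apply: contraTneq ku => ->; rewrite unitr0.
  have eV : (1, 1) \in [seq (1 * sgz x.1, g.2^-1 * x.2) | x <- W].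
    by apply/mapP; exists (1, g.2) => //=; rewrite mulVr.
  have /mapP[w wW ->] := sset_sub DC sV eC eV hC.
  rewrite /act /= mul1r mulrAC mulVr // mul1r.
  by rewrite sgz_abs1 ?lW //; apply: WX.
have eV : (1, 1) \in [seq x + y | x <- W, y <- torsion].
  apply/allpairsP; exists ((1, g.2), (0, 1)); rewrite mem_torsion; split=> //=.
  by rewrite k0 -[RHS]/(1 + 0, 0 + 1) addr0 add0r.
have /allpairsP[[w t] /= [wW]] := sset_sub DC (sset_add sW sset_torsion) eC eV hC.
rewrite mem_torsion => /eqP t0 ->; rewrite /act /= t0 addr0 k0 mulr0.
have wX := WX w wW; suff <- : w.2 = 0 by [].
by apply/eqP; rewrite (D_Z DX wX gX) k0.
Qed.

(** The orbit of [g] is an S-set containing [g], hence contains [X]; [orbit_sub] is the converse. *)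
Lemma orbitP (X : {fset G}) g y : D X -> g \in X ->
  reflect (exists2 h, h \in C & y = act h g) (y \in X).
Proof.
move=> DX gX; apply: (iffP idP) => [yX|[h hC ->]]; last exact: orbit_sub.
have gs : g \in [seq act h g | h <- C].
  by apply/mapP; exists (1, 1) => //; rewrite /act !mul1r; case: (g).
by have /mapP[h hC ->] := sset_sub DX (sset_orbit g) gX gs yX; exists h.
Qed.

End IntZp.

(** * From Schur rings over F to class functions, and the theorem *)

Lemma In_map (S T : Type) (f : S -> T) (s : seq S) y :
  List.In y [seq f x | x <- s] <-> exists2 x, List.In x s & f x = y.
Proof.
by rewrite List.in_map_iff; split=> [[x [? ?]]|[x ? ?]]; exists x.
Qed.

Lemma In_mem (T : eqType) (s : seq T) x : List.In x s <-> x \in s.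
Proof.
elim: s => //= y s IH; rewrite inE; split=> [[->|/IH ->]|/orP[/eqP->|/IH]]; rewrite ?eqxx ?orbT //.
  by left.
by right.
Qed.

Lemma natr_char0_inj (F : fieldType) : [pchar F] =i pred0 -> injective (fun n => n%:R : F).
Proof.
move=> /pcharf0P F0 m n; wlog mn : m n / (m <= n)%N.
  by move=> W; have [/W//|/ltnW nm mE] := leqP m n; apply/esym/W.
move=> /esym/eqP; rewrite -subr_eq0 -natrB // F0 => /eqP nm.
by apply/eqP; rewrite eqn_leq mn -subn_eq0 nm.
Qed.

Section Automorphic.
Variables (F : fieldType) (p : nat) (D : {fset grp p} -> Prop).
Hypothesis F_char0 : [pchar F] =i pred0.
Hypothesis D_schur : schur_partition F D.
Local Notation G := (int * 'Z_p)%type.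

Lemma class_cover (g : G) : exists2 C, D C & g \in C.
Proof. by have [[_ [cov _]] _] := D_schur; have [C [? ?]] := cov g; exists C. Qed.

Lemma class_disj C E (g : G) : D C -> D E -> g \in C -> g \in E -> C = E.
Proof. by have [[_ [_ dis]] _] := D_schur; exact: dis. Qed.

Lemma lin_comb_class_fun (f : G -> F) : lin_comb D f -> class_fun D f.
Proof.
move=> [l [lD lf]] C g h DC gC hC; rewrite !lf.
elim: l lD {lf} => [|e l IH] lD; first by rewrite !big_nil.
rewrite !big_cons IH; last by move=> e' le'; apply: lD; right.
congr (_ * _ + _); rewrite /csum.
by rewrite (class_sset class_disj (lD e (or_introl erefl)) DC gC hC).
Qed.

(** Induction on a list containing the support: subtracting [f x] times the class sum of x leaves a
    class function vanishing at x. *)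
Lemma class_fun_lin_comb (f : G -> F) :
  in_group_alg f -> class_fun D f -> lin_comb D f.
Proof.
move=> [s]; elim: s f => [|x s IH] f fs cf.
  exists [::]; split=> // g; rewrite big_nil; apply/eqP.
  by apply: contraT => /fs.
have [C DC xC] := class_cover x.
have [||l [lD lf]] := IH (fun g => f g - f x * csum F C g).
- move=> g; apply: contraR => gs; rewrite subr_eq0; apply/eqP.
  rewrite /csum; case: (boolP (g \in C)) => [gC|gC]; first by rewrite mulr1 (cf C g x).
  rewrite mulr0; apply/eqP; apply: contraR gC => /fs; rewrite inE (negPf gs) orbF.
  by move/eqP->.
- move=> E g h DE gE hE; rewrite (cf E g h) // /csum.
  by rewrite (class_sset class_disj DC DE gE hE).
exists ((C, f x) :: l); split=> [e [<- //|/lD //]|g].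
by rewrite big_cons -lf /= addrC subrK.
Qed.

(** Characteristic 0 enters here: natural numbers embed in F, so equal coefficients in F mean equal
    multiplicities. *)
Lemma class_mul (C E : {fset G}) : D C -> D E ->
  class_fun D (fun g => count_mem g [seq x + y | x <- C, y <- E]).
Proof.
move=> DC DE X g h DX gX hX; apply: (natr_char0_inj F_char0).
have [_ [_ [_ mulD]]] := D_schur.
have cE k : cprod F C E k = (count_mem k [seq x + y | x <- C, y <- E])%:R.
  rewrite -sum1_count big_mkcond big_allpairs_dep natr_sum; apply: eq_bigr => x _.
  by rewrite natr_sum; apply: eq_bigr => y _ /=; case: eqP.
by rewrite -!cE; apply: (lin_comb_class_fun (mulD C E DC DE) DX gX hX).
Qed.

Lemma class_opp (C : {fset G}) : D C -> D [fset - x | x in C]%fset.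
Proof. by have [_ [_ [oppD _]]] := D_schur; exact: oppD. Qed.

Lemma class_one : D [fset 0 : G]%fset.
Proof. by have [_ [? _]] := D_schur. Qed.

Lemma snd0_class_fun : is_S_subset D (@inZ p) -> class_fun D (fun g : G => g.2 == 0).
Proof.
move=> [Ds [DsD ZE]].
suff H C g h : D C -> g \in C -> h \in C -> g.2 = 0 -> h.2 = 0.
  by move=> C g h DC gC hC; apply/eqP/eqP; apply: (H C).
move=> DC gC hC /ZE [C' [DsC' gC']].
by apply/ZE; exists C'; split=> //; rewrite -(class_disj DC (DsD _ DsC') gC gC').
Qed.

End Automorphic.

Lemma act_aut (p : nat) (h : grp p) :
  prime p -> `|h.1|%N = 1%N -> h.2 != 0 -> is_aut (act h).
Proof.
move=> p_pr h1 h2; have hu := unit_Zp p_pr h2.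
have hh : h.1 * h.1 = 1 by rewrite -{1}(sgz_abs1 h1) -abszEsg h1.
split=> [x y|].
  by rewrite /act /gmul /= !mulrDr.
exists (act (h.1, h.2^-1)) => -[a b]; rewrite /act /= !mulrA hh mul1r; congr (_, _).
  by rewrite mulVr ?mul1r.
by rewrite divrr ?mul1r.
Qed.

Theorem theorem3p4 (F : fieldType) (p : nat) (D : {fset grp p} -> Prop) :
  [pchar F] =i pred0 ->
  prime p ->
  schur_partition F D ->
  is_S_subset D (@inZ p) ->
  automorphic F D.
Proof.
move=> F0 p_pr SD SZ.
have cov := class_cover SD; have dis := class_disj SD; have one := class_one SD.
have mul := class_mul F0 SD; have opp := class_opp SD; have Z := snd0_class_fun SD SZ.
have [C DC eC] := cov (1, 1).
have orb X g y := @orbitP p p_pr D cov one dis mul opp Z C DC eC X g y.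
have actA (g h x : int * 'Z_p) : act g (act h x) = act (act g h) x.
  by rewrite /act /= !mulrA.
have act1 (x : int * 'Z_p) : act (1, 1) x = x.
  by rewrite /act /= !mul1r; case: x.
have actC (g h : int * 'Z_p) : act g h = act h g.
  by rewrite /act mulrC [g.2 * _]mulrC.
have inHP h : h \in C -> inH [seq act h | h <- C] (act h).
  by move=> hC; exists (act h) => //; apply/In_map; exists h => //; apply/In_mem.
exists [seq act h | h <- C]; split; first split; [|split; [|split]|].
- move=> _ /In_map[h /In_mem hC <-]; apply: act_aut => //.
    exact: (gen_level p_pr cov one dis mul opp Z DC eC).
  exact: (gen_snd Z DC eC).
- by have [k kH kE] := inHP _ eC; exists k => // x; rewrite -kE act1.
- move=> _ _ /In_map[g /In_mem gC <-] /In_map[h /In_mem hC <-].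
  (* [orbitP] for X = C: the class is closed under [act]. *)
  have ghC : act g h \in C by apply/(orb _ _ _ DC hC); exists g.
  by have [k kH kE] := inHP _ ghC; exists k => // x; rewrite -kE /= actA.
- move=> _ /In_map[h /In_mem hC <-].
  (* The identity (1, 1) lies in the orbit of [h], which yields the inverse [k] of [h] inside
     [C]. *)
  have /(orb _ _ _ DC hC)[k kC kh] := eC.
  exists (act k); split; first exact: inHP.
  by split=> x; rewrite actA -?kh ?[act h k]actC -?kh act1.
(* Both sides consist of the finitely supported functions constant on classes, since classes are
   orbits. *)
move=> f; split=> [lf|[ff fH]].
  split.
    have [l [_ lE]] := lf; exists (flatten [seq enum_fset e.1 | e <- l]) => g.
    rewrite lE; apply: contraR => gl; apply/eqP; elim: l gl {lE lf} => [|e l IH] /=.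
      by rewrite big_nil.
    rewrite mem_cat negb_or big_cons => /andP[ge /IH ->].
    by rewrite /csum (negPf ge) mulr0 addr0.
  move=> _ /In_map[h /In_mem hC <-] g; have [X DX gX] := cov g.
  apply: (lin_comb_class_fun SD lf DX _ gX).
  by apply/(orb _ _ _ DX gX); exists h.
apply: (class_fun_lin_comb SD ff) => X g y DX gX /(orb _ _ _ DX gX)[h hC ->].
by rewrite fH //; apply/In_map; exists h => //; apply/In_mem.
Qed.
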